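(* Let $m\ge 3$ be an integer. For every integer $N\ge 0$ let $H_N=\det\left(\gamma^{(2m)}_{i+j+3-m}(t)\right)_{i,j=0}^{N-1}$ (with $H_0=1$). Then $$H_N=\begin{cases}\xi_1\, t^{m^2n(n-1)/2}\,[n+1]_{t^m}^2, & \text{if } N=mn \text{ with } n\ge 0,\\ (-1)^{m-1}\xi_1\, t^{m(n-1)(mn-2)/2}\,R(m;t,n-1), & \text{if } N=mn-1 \text{ with } n\ge 1,\\ -\xi_1\, t^{m(n-1)(mn-4)/2}\,[n]_{t^m}^2, & \text{if } N=mn-2 \text{ with } n\ge 1,\\ 0, & \text{otherwise},\end{cases}$$ where $\xi_1=(-1)^{nm(m-1)/2}$ and $$R(m;t,n)=m[m]_t\left(\sum_{i=0}^{n}\binom{i+2}{2}t^{mi}+\sum_{i=n+1}^{2n}\binom{2n-i+2}{2}t^{mi}\right).$$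
   Context: The Narayana polynomials are $\gamma_n(t)=\sum_{k=0}^{n}\binom{n}{k}\binom{n-1}{k}\frac{1}{k+1}t^k$ (so $\gamma_0(t)=1$), with generating function $\gamma(t,q)=\sum_{n\ge0}\gamma_n(t)q^n$. Let $G(t,q)=(\gamma(t,q)-1)/q$. For $m\ge1$ the polynomials $\gamma^{(2m)}_n(t)$ are defined by $\sum_{n\ge0}\gamma^{(2m)}_n(t)q^n=G(t,q)^m$, and $\gamma^{(2m)}_i(t)=0$ for $i<0$. Equivalently, $\gamma^{(2m)}_{n-m}(t)$ is the coefficient of $q^n$ in $(\gamma(t,q)-1)^m$. The $q$-number is $[n]_x=1+x+\cdots+x^{n-1}$. *)

(* Defs.v *)
From HB Require Import structures.
From mathcomp Require Import all_boot all_order all_algebra.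
Set Implicit Arguments. Unset Strict Implicit. Unset Printing Implicit Defensive.
Import Order.TTheory GRing.Theory Num.Theory.
Local Open Scope ring_scope.

(* Narayana polynomial gamma_n(t) = sum_{k=0}^n C(n,k) C(n-1,k) / (k+1) t^k.
   For n = 0 this gives 1 (C(0,0) C(0,0) / 1 = 1), matching gamma_0 = 1. *)
Definition narayana (n : nat) : {poly rat} :=
  \poly_(k < n.+1) (('C(n, k) * 'C(n.-1, k))%:R / (k.+1)%:R).

(* Truncation of G(t,q) = (gamma(t,q) - 1)/q = sum_{k>=1} gamma_k q^(k-1)
   to q-degree < d, as a polynomial in q with coefficients in {poly rat}. *)
Definition Gtrunc (d : nat) : {poly {poly rat}} :=
  \sum_(0 <= k < d) (narayana k.+1)%:P * 'X^k.

(* gamma^{(2m)}_i(t) = coefficient of q^i in G(t,q)^m, and 0 for i < 0.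
   Since G^m mod q^(i+1) only depends on G mod q^(i+1), the coefficient of
   q^i in (Gtrunc (i+1))^m is the coefficient of q^i in the series G^m. *)
Definition gamma2m (m : nat) (i : int) : {poly rat} :=
  match i with
  | Posz j => ((Gtrunc j.+1) ^+ m)`_j
  | Negz _ => 0
  end.

Definition hankelH (m N : nat) : {poly rat} :=
  \det (\matrix_(i < N, j < N) gamma2m m ((i + j + 3)%:Z - m%:Z)).

Definition qnum (n : nat) (x : {poly rat}) : {poly rat} :=
  \sum_(i < n) x ^+ i.

Definition Rpoly (m n : nat) : {poly rat} :=
  m%:R * qnum m 'X *
  (\sum_(0 <= i < n.+1) ('C(i + 2, 2))%:R * 'X ^+ (m * i)
   + \sum_(n.+1 <= i < (2 * n).+1) ('C(2 * n - i + 2, 2))%:R * 'X ^+ (m * i)).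

(* xi_1 = (-1)^(n m (m-1)/2); m(m-1) is even so the division is exact. *)
Definition xi1 (m n : nat) : {poly rat} :=
  (-1) ^+ (n * ((m * (m - 1)) %/ 2)).

(* Main.v *)
Require Import Defs.
From HB Require Import structures.
From mathcomp Require Import all_boot all_order all_algebra.
From mathcomp Require Import ring zify.
Set Implicit Arguments. Unset Strict Implicit. Unset Printing Implicit Defensive.
Import Order.TTheory GRing.Theory Num.Theory.
Local Open Scope ring_scope.

(** Let [u = q G]; the Narayana numbers satisfy [u = q (1 + u) (1 + t u)], so the
    Hankel entries [[q^(i+j+3)] u^m] are the moments [L (z^(i+j+2))] of the
    functional [L (z^k) = [q^(k+1)] u^m], where [z = 1/q].  As
    [z - (1 + t) = u^-1 + t u], [L] extracts a coefficient in a Chebyshev basis.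

    Because of the factor [z^2], the determinant is the (0,0) cofactor of the
    Hankel matrix of [L] of size [N+1].  Products [D_k P_r] and [D_k V_s] of
    Chebyshev polynomials in [u^-m + t^m u^m] and in [u^-1 + t u] form two monic
    bases in which that matrix becomes block diagonal, the block of index [k]
    being [t^(mk)] times an antidiagonal matrix.  Hence the cofactor is the
    bilinear form of the adjugate of this sparse matrix at the values of the two
    bases at [z = 0], i.e. at [u = -1].  The matrix is invertible if [m] divides
    [N+1]; its adjugate has rank one if [N+1] is [1] or [-1] modulo [m], and
    vanishes otherwise. *)

(** * Adjugates, determinants and cofactors *)

Lemma adj_mulmx (R : idomainType) n (A B : 'M[R]_n) :
  \adj (A *m B) = \adj B *m \adj A.
Proof.
(* For nonsingular factors both sides agree after scaling by the determinants, which cancel. The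
   domain [S] is left free because the claim is applied over [{poly R}]. *)
have aux (S : idomainType) (C D : 'M[S]_n) : \det C != 0 -> \det D != 0 ->
    \adj (C *m D) = \adj D *m \adj C.
  move=> C0 D0; have CD0 : \det C * \det D != 0 by rewrite mulf_neq0.
  have E : (\det C * \det D) *: \adj (C *m D) =
           (\det C * \det D) *: (\adj D *m \adj C).
    rewrite -{2}det_mulmx -[RHS]mul_scalar_mx -[in RHS]mul_adj_mx.
    rewrite -[RHS]mulmxA -(mulmxA C) (mulmxA D) mul_mx_adj mul_scalar_mx.
    by rewrite -!scalemxAr mul_mx_adj mul_mx_scalar scalerA mulrC.
  apply/matrixP=> i j; apply: (mulfI CD0).
  by move/matrixP/(_ i j): E; rewrite !mxE.
(* Perturbing by ['X] makes both matrices nonsingular. *)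
pose ev := map_mx (horner_eval (0 : R)) : 'M_n -> 'M_n.
pose ch (M : 'M[R]_n) := char_poly_mx (- M).
have evch M : ev (ch M) = M.
  by apply/matrixP=> i j; rewrite !mxE /horner_eval !hornerE hornerMn hornerX mul0rn add0r opprK.
have ch0 M : \det (ch M) != 0 by apply/monic_neq0/char_poly_monic.
rewrite -[in LHS](evch A) -[in LHS](evch B) /ev -map_mxM -map_mx_adj aux //.
by rewrite map_mxM !map_mx_adj -!/(ev _) !evch.
Qed.

(** Entries come from a function on [nat], so that shifting indices and splitting blocks need no
    ordinal casts. *)
Definition ndet (R : comNzRingType) n (f : nat -> nat -> R) :=
  \det (\matrix_(i < n, j < n) f i j).

Lemma eq_ndet (R : comNzRingType) n (f g : nat -> nat -> R) :
  (forall i j, (i < n)%N -> (j < n)%N -> f i j = g i j) -> ndet n f = ndet n g.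
Proof.
by move=> fg; congr (\det _); apply/matrixP=> i j; rewrite !mxE fg.
Qed.

Lemma ndet_block (R : comNzRingType) p q (f : nat -> nat -> R) :
  (forall i j, (i < p)%N -> (j < q)%N -> f i (p + j)%N = 0) ->
  ndet (p + q) f = ndet p f * ndet q (fun i j => f (p + i)%N (p + j)%N).
Proof.
move=> f0; rewrite /ndet -[X in \det X]submxK.
set B := ursubmx _; have -> : B = 0.
  by apply/matrixP=> i j; rewrite !mxE /= f0.
rewrite det_lblock; congr (_ * _); congr (\det _);
  by apply/matrixP=> i j; rewrite !mxE.
Qed.

Lemma ndet0 (R : comNzRingType) (f : nat -> nat -> R) : ndet 0 f = 1.
Proof. exact: det_mx00. Qed.

Lemma ndetZ (R : comNzRingType) n a (f : nat -> nat -> R) :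
  ndet n (fun i j => a * f i j) = a ^+ n * ndet n f.
Proof.
rewrite /ndet -detZ; congr (\det _); apply/matrixP=> i j; by rewrite !mxE.
Qed.

(** The single 1 of the first row lies in the last column; its sign accounts for the term n in
    C(n+1,2) = n + C(n,2). *)
Lemma ndet_anti (R : comNzRingType) n :
  ndet n (fun i j => (i + j == n.-1)%:R : R) = (-1) ^+ 'C(n, 2).
Proof.
elim: n => [|n IH]; first by rewrite ndet0.
rewrite /ndet (expand_det_row _ ord0) (bigD1 ord_max) //= big1 ?addr0; last first.
  move=> j jn; rewrite !mxE /= ?add0n.
  have -> : (j == n :> nat) = false by apply: negbTE; apply: contraNneq jn => jn; apply/eqP/val_inj.
  by rewrite mul0r.
rewrite !mxE /= ?add0n eqxx mul1r /cofactor /= ?add0n binS bin1 exprD mulrC.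
congr (_ * _); rewrite -IH; congr (\det _); apply/matrixP=> i j; rewrite !mxE /=.
rewrite /bump /= add1n leqNgt ltn_ord add0n; congr (_%:R); move: (ltn_ord i) (ltn_ord j); lia.
Qed.

Lemma cofactor_zero_row (R : comNzRingType) n (A : 'M[R]_n) c i j :
  i != c -> (forall k, A c k = 0) -> cofactor A i j = 0.
Proof.
move=> ic Ac; rewrite /cofactor.
have [c' cE] : exists c', c = lift i c'.
  by case: (unliftP i c) => [c' ->|E]; [exists c'|move: ic; rewrite E eqxx].
rewrite (expand_det_row _ c') big1 ?mulr0 // => k _.
by rewrite !mxE -cE Ac mul0r.
Qed.

Lemma cofactor_zero_col (R : comNzRingType) n (A : 'M[R]_n) c i j :
  j != c -> (forall k, A k c = 0) -> cofactor A i j = 0.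
Proof.
move=> jc Ac; rewrite -cofactor_tr (@cofactor_zero_row _ _ _ c) // => k.
by rewrite mxE.
Qed.

(** A 1 placed at (c, c) leaves the complementary minor unchanged and is the only nonzero entry of
    row [c]. *)
Lemma cofactor_zero_cross (R : comNzRingType) n (A : 'M[R]_n) c :
  (forall k, A c k = 0) ->
  cofactor A c c = \det (A + delta_mx c c).
Proof.
move=> Ac; rewrite (expand_det_row _ c) (bigD1 c) //= big1 ?addr0; last first.
  by move=> j jc; rewrite !mxE eqxx (negbTE jc) Ac addr0 mul0r.
rewrite !mxE Ac !eqxx add0r mul1r; congr (_ * \det _); apply/matrixP=> i j.
by rewrite !mxE [_ == c]eq_sym (negbTE (neq_lift _ _)) addr0.
Qed.

(** * Coefficients of the powers of u, and Narayana polynomials *)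

(* [ucoef t n m] is [[q^n] u^m] for [u = q (1 + u) (1 + t u)]. *)
Fixpoint ucoef (R : comNzRingType) (t : R) n m : R :=
  match n, m with
  | 0, 0 => 1
  | 0, _.+1 => 0
  | _.+1, 0 => 0
  | n'.+1, m'.+1 =>
      ucoef t n' m' + (1 + t) * ucoef t n' m'.+1 + t * ucoef t n' m'.+2
  end.

Lemma ucoefS (R : comNzRingType) (t : R) n m :
  ucoef t n.+1 m.+1 =
  ucoef t n m + (1 + t) * ucoef t n m.+1 + t * ucoef t n m.+2.
Proof. by []. Qed.

Lemma ucoef0 (R : comNzRingType) (t : R) m : ucoef t 0 m = (m == 0)%:R.
Proof. by case: m. Qed.

Lemma ucoefn0 (R : comNzRingType) (t : R) n : ucoef t n.+1 0 = 0.
Proof. by []. Qed.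

Opaque ucoef.

Lemma ucoef_1 (R : comNzRingType) (t : R) m : ucoef t 1 m = (m == 1)%:R.
Proof.
case: m => [|m]; first exact: ucoefn0.
by rewrite ucoefS !ucoef0 !mulr0 !addr0.
Qed.

Lemma ucoef_lt (R : comNzRingType) (t : R) n m :
  (n < m)%N -> ucoef t n m = 0.
Proof.
elim: n m => [|n IH] [|m] // nm.
by rewrite ucoefS !IH ?mulr0 ?addr0 //; lia.
Qed.

(** This is u^m u = u^(m+1), coefficient by coefficient: applying the recursion to the first factor
    commutes with the convolution. *)
Lemma ucoef_conv (R : comNzRingType) (t : R) n m :
  \sum_(i < n.+1) ucoef t i m * ucoef t (n - i) 1 = ucoef t n m.+1.
Proof.
elim: n m => [|n IH] m.
  by rewrite big_ord_recl big_ord0 !ucoef0 mulr0 addr0.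
case: m => [|m].
  rewrite big_ord_recl big1 => [|i _]; first by rewrite ucoef0 mul1r addr0.
  by rewrite lift0 ucoefn0 mul0r.
rewrite big_ord_recl ucoef0 mul0r add0r.
rewrite (eq_bigr (fun i : 'I_n.+1 => ucoef t i m * ucoef t (n - i) 1 +
    (1 + t) * (ucoef t i m.+1 * ucoef t (n - i) 1) +
    t * (ucoef t i m.+2 * ucoef t (n - i) 1))) => [|i _]; last first.
  by rewrite lift0 subSS ucoefS !mulrDl -!mulrA.
by rewrite !big_split /= -!mulr_sumr !IH -ucoefS.
Qed.

(** The value at k = 0 must be 0, whereas ['C(n, k.-1)] would give 1 there. *)
Definition bin_pred n k := if k is k'.+1 then 'C(n, k') else 0%N.

Lemma bin_predS n k : 'C(n.+1, k) = ('C(n, k) + bin_pred n k)%N.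
Proof. by case: k => [|k] /=; rewrite ?bin0 ?binS. Qed.

(** A 2 by 2 determinant of binomials, which satisfies the recursion by Pascal's rule. The formula
    vanishes at m = -1, in agreement with [ucoefn0]. *)
Lemma coef_ucoef (n m j : nat) :
  (ucoef ('X : {poly rat}) n.+1 m.+1)`_j =
  ('C(n, j) * 'C(n, j + m))%:R - (bin_pred n j * 'C(n, j + m.+1))%:R.
Proof.
have aux (a b c : {poly rat}) k : (a + (1 + 'X) * b + 'X * c)`_k =
    a`_k + b`_k + (if k is k'.+1 then b`_k' + c`_k' else 0).
  rewrite mulrDl mul1r !coefD !coefXM; case: k => [|k] /=; ring.
elim: n m j => [|n IH] m j.
  rewrite ucoefS !ucoef0 !mulr0 !addr0; case: m => [|m].
    case: j => [|j]; first by rewrite coef1 subr0.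
    by rewrite coef1 /= (@bin_small 0 (j.+1 + 1)) ?muln0 ?subr0 //; lia.
  rewrite coef0 (@bin_small 0 (j + m.+1)) ?(@bin_small 0 (j + m.+2)); [|lia..].
  by rewrite !muln0 subrr.
rewrite [ucoef _ n.+2 _]ucoefS; case: m => [|m].
  rewrite ucoefn0 aux !IH; case: j => [|j].
    rewrite coef0 /= ?addn0 ?add0n ?binS ?bin0; ring.
  rewrite !IH coef0 /= ?addn0 ?addn1 ?addnS ?addSn ?addn0 ?binS ?bin_predS !natrM !natrD; ring.
rewrite aux !IH; case: j => [|j].
  rewrite /= ?addn0 ?add0n ?addn1 ?binS ?bin0; ring.
rewrite !IH /= ?addnS ?addSn ?binS ?bin_predS !natrM !natrD; ring.
Qed.

Lemma ucoef1 n : ucoef ('X : {poly rat}) n.+1 1 = narayana n.+1.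
Proof.
apply/polyP=> k; rewrite coef_ucoef coef_poly.
case: ltnP => [kn|kn]; last first.
  rewrite addn0 bin_small ?mul0n; last by lia.
  by rewrite (@bin_small n (k + 1)) ?muln0 ?subrr //; lia.
have k1 : (k.+1)%:R != 0 :> rat by rewrite pnatr_eq0.
apply: (mulfI k1); rewrite mulrCA divff // mulr1 addn0 addn1 /=.
rewrite mulrBr -!natrM; apply/eqP; rewrite subr_eq -natrD eqr_nat; apply/eqP.
have E1 : (k.+1 * 'C(n, k.+1) = (n - k) * 'C(n, k))%N by rewrite mul_bin_left.
case: k kn k1 E1 => [|k] kn _ E1; first by rewrite /= !bin0; lia.
have E2 : (k.+1 * 'C(n, k.+1) = (n - k) * 'C(n, k))%N by rewrite mul_bin_left.
rewrite /= binS.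
have [kn'|kn'] := ltnP n k.+1.
  by rewrite (bin_small kn') (@bin_small n k.+2) ?muln0 //; lia.
(* Writing n - k as 1 + (n - k.+1) leaves the same truncated difference as in [E1]. *)
have E3 : (k.+2 * 'C(n, k.+1) =
    'C(n, k.+1) + ('C(n, k) + (n - k.+1) * 'C(n, k)))%N.
  by rewrite -mulSn mulSn E2; congr (_ + _ * _)%N; lia.

nia.
Qed.

(** As u = q G, the coefficient of q^j in G^p is that of q^(j+p) in u^p; truncation at [d] does not
    affect degrees below [d]. *)
Lemma coef_Gtrunc_exp d p j : (j < d)%N ->
  (Gtrunc d ^+ p)`_j = ucoef 'X (j + p) p.
Proof.
have G1 k : (k < d)%N -> (Gtrunc d)`_k = ucoef 'X k.+1 1.
  move=> kd; rewrite ucoef1 /Gtrunc coef_sum (bigD1_seq k) ?mem_index_iota ?iota_uniq //=.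
  rewrite coefCM coefXn eqxx mulr1 big1 ?addr0 // => i ik.
  by rewrite coefCM coefXn eq_sym (negbTE ik) mulr0.
elim: p j => [|p IH] j jd; first by rewrite expr0 coef1 addn0; case: j {jd}.
rewrite exprSr coefM -ucoef_conv addnS.
rewrite -(big_mkord xpredT (fun i => ucoef 'X i p * ucoef 'X ((j + p).+1 - i) 1)).
(* The terms with i < p vanish because u^p has order p, and the last one because u has no constant
   term; [j.+1] terms remain. *)
rewrite (@big_cat_nat _ _ _ p) /=; [|lia|lia].
rewrite [X in _ = X + _]big_nat [X in _ = X + _]big1 ?add0r; last first.
  by move=> i ip; rewrite ucoef_lt ?mul0r //; lia.
rewrite big_nat_recr /=; last by lia.
rewrite subnn mulr0 addr0 -[X in \sum_(X <= _ < _) _]add0n big_addn.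
have -> : ((j + p).+1 - p = j.+1)%N by lia.
rewrite big_mkord; apply: eq_bigr => i _.
have ij := ltn_ord i; rewrite IH ?G1; [|lia..].
by congr (_ * ucoef _ _ _); lia.
Qed.

(** For k < m both sides vanish: the index on the left is negative, and u^m has order m. *)
Lemma gamma2mE m k : gamma2m m (k%:Z - m%:Z) = ucoef 'X k m.
Proof.
case: (leqP m k) => mk; last first.
  rewrite ucoef_lt // /gamma2m; case E: (_ - _)%R => [n|n] //; lia.
by rewrite subzn // /gamma2m coef_Gtrunc_exp ?subnK.
Qed.

(** * Chebyshev recurrences *)

Section LinearRecurrence.
Variable A : comNzRingType.
Implicit Types a x y : A.

(** Rescaled Chebyshev polynomials, of the second kind for a = 1 and of the first kind for a = 2:
    with x = p + r and y = p r they are the sum of all p^i r^(n-i), and p^n + r^n. *)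
Fixpoint cheb a x y n : A :=
  if n is n'.+1 then
    if n' is n''.+1 then x * cheb a x y n' - y * cheb a x y n'' else x
  else a.

Lemma chebSS a x y n :
  cheb a x y n.+2 = x * cheb a x y n.+1 - y * cheb a x y n.
Proof. by []. Qed.

Arguments cheb : simpl never.

Lemma cheb_ind (P : nat -> Prop) :
  P 0%N -> P 1%N -> (forall n, P n -> P n.+1 -> P n.+2) -> forall n, P n.
Proof.
move=> P0 P1 PS n; suff [] : P n /\ P n.+1 by [].
by elim: n => [|n [IH1 IH2]]; split=> //; apply: PS.
Qed.

(** Here p = e and r = e y, with product y because e^2 = 1. Evaluation at z = 0 uses e = -1 and e =
    (-1)^m. *)
Lemma cheb1_val e y n : e ^+ 2 = 1 ->
  cheb 1 (e * (1 + y)) y n = e ^+ n * \sum_(i < n.+1) y ^+ i.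
Proof.
move=> e2; elim/cheb_ind: n => [||n IH1 IH2].
- by rewrite big_ord_recl big_ord0 addr0 mulr1.
- by rewrite !big_ord_recl big_ord0 /= addr0 !expr1.
rewrite chebSS IH1 IH2 [\sum_(i < n.+3) _]big_ord_recr.
rewrite [\sum_(i < n.+2) _]big_ord_recr /= !exprS.
set s := \sum_(i < n.+1) _.
transitivity (e ^+ 2 * e ^+ n * (1 + y) * (s + y * y ^+ n) - y * (e ^+ n * s)); first by ring.
by have -> : e * (e * e ^+ n) = e ^+ 2 * e ^+ n; [ring | rewrite e2; ring].
Qed.

Lemma cheb2_val e y n : e ^+ 2 = 1 ->
  cheb 2 (e * (1 + y)) y n = e ^+ n * (1 + y ^+ n).
Proof.
move=> e2; elim/cheb_ind: n => [||n IH1 IH2].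
- by rewrite !expr0 mul1r.
- by rewrite !expr1.
rewrite chebSS IH1 IH2 !exprS.
transitivity (e ^+ 2 * e ^+ n * (1 + y) * (1 + y * y ^+ n) - y * (e ^+ n * (1 + y ^+ n))); first by ring.
by have -> : e * (e * e ^+ n) = e ^+ 2 * e ^+ n; [ring | rewrite e2; ring].
Qed.
End LinearRecurrence.
Arguments cheb : simpl never.

Lemma rmorph_cheb (A B : comNzRingType) (f : {rmorphism A -> B}) (a x y : A) n :
  f (cheb a x y n) = cheb (f a) (f x) (f y) n.
Proof.
elim/cheb_ind: n => // n IH1 IH2.
by rewrite !chebSS rmorphB !rmorphM IH1 IH2.
Qed.

Definition monic_deg (R : nzRingType) n (p : {poly R}) :=
  (p \is monic) /\ size p = n.+1.

Lemma monic_degM (R : nzRingType) n k (p q : {poly R}) :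
  monic_deg n p -> monic_deg k q -> monic_deg (n + k) (p * q).
Proof.
move=> [p1 sp] [q1 sq]; split; first by rewrite monicMl.
by rewrite size_Mmonic ?monic_neq0 // sp sq addnS.
Qed.

Lemma monic_cheb (R : comNzRingType) d (a y : R) (x : {poly R}) n :
  (0 < d)%N -> monic_deg d x -> monic_deg (n.+1 * d) (cheb a%:P x y%:P n.+1).
Proof.
move=> d0 [x1 sx].
(* The polynomial of index 0 is a constant that may fail to be monic, so the induction carries only
   a size bound for the lower index. *)
suff H : (size (cheb a%:P x y%:P n) <= (n * d).+1)%N /\
   monic_deg (n.+1 * d) (cheb a%:P x y%:P n.+1) by case: H.
elim: n => [|n [IH1 IH2]].
  by rewrite mul1n /= size_polyC; split; [case: (_ != _)|split].
have [_ s1] := IH2; split; first by rewrite s1.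
rewrite chebSS mulSn.
have [m2 s2] := monic_degM (conj x1 sx) IH2.
have lt : (size (- (y%:P * cheb a%:P x y%:P n)) < size (x * cheb a%:P x y%:P n.+1)%R)%N.
  rewrite size_polyN s2 mul_polyC (leq_ltn_trans (size_scale_leq _ _)) //.
  rewrite (leq_ltn_trans IH1) // mulSn; lia.
split; last by rewrite size_polyDl.
by rewrite monicE lead_coefDl // -monicE.
Qed.

Lemma monic_cheb1 (R : comNzRingType) d (y : R) (x : {poly R}) n :
  (0 < d)%N -> monic_deg d x -> monic_deg (n * d) (cheb 1 x y%:P n).
Proof.
move=> d0 dx; case: n => [|n]; last exact: monic_cheb.
by split; rewrite ?monic1 ?size_poly1.
Qed.

(** * The moment functional and its duality with Chebyshev polynomials *)

Section MomentFunctional.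
Variables (R : comNzRingType) (t : R).
Implicit Types f : {poly R}.

Definition momL m f := \sum_(k < size f) f`_k * ucoef t k.+1 m.

Lemma momL_widen m n f : (size f <= n)%N ->
  momL m f = \sum_(k < n) f`_k * ucoef t k.+1 m.
Proof.
move=> fn; rewrite /momL -(subnKC fn) big_split_ord /= [X in _ = _ + X]big1 ?addr0 // => i _.
by rewrite nth_default ?mul0r // leq_addr.
Qed.

Lemma momL_is_linear m : linear_for *%R (momL m).
Proof.
move=> a f g; pose n := maxn (size f) (size g).
have afg : (size (a *: f + g)%R <= n)%N.
  rewrite (leq_trans (size_polyD _ _)) // /n geq_max leq_maxr andbT.
  by rewrite (leq_trans (size_scale_leq _ _)) // leq_maxl.
rewrite !(@momL_widen _ n) ?leq_maxl ?leq_maxr // mulr_sumr -big_split /=.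
by apply: eq_bigr => i _; rewrite coefD coefZ mulrDl mulrA.
Qed.

HB.instance Definition _ m :=
  GRing.isLinear.Build R {poly R} R *%R (momL m) (momL_is_linear m).

Lemma momL0 f : momL 0 f = 0.
Proof. by rewrite /momL big1 // => i _; rewrite ucoefn0 mulr0. Qed.

Lemma momLXn m n : momL m 'X^n = ucoef t n.+1 m.
Proof.
rewrite /momL size_polyXn big_ord_recr /= coefXn eqxx mul1r big1 ?add0r // => i _.
by rewrite coefXn ltn_eqF ?mul0r // ltn_ord.
Qed.

Lemma momL_small m f : (size f < m)%N -> momL m f = 0.
Proof.
move=> fm; rewrite /momL big1 // => i _.
by rewrite ucoef_lt ?mulr0 // (leq_ltn_trans (ltn_ord i)).
Qed.

Let x : {poly R} := 'X - (1 + t)%:P.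
Let S m := cheb 2%:P x t%:P m.

(** [x] stands for u^-1 + t u, which sends u^(m+1) to u^m + t u^(m+2). *)
Lemma momLx m f :
  momL m.+1 (x * f) = momL m f + t * momL m.+2 f.
Proof.
rewrite mulrBl mul_polyC linearB linearZ /=.
have -> : momL m.+1 ('X * f) =
    momL m f + (1 + t) * momL m.+1 f + t * momL m.+2 f.
  rewrite (@momL_widen _ (size f).+1); last first.
    have [->|f0] := eqVneq f 0; first by rewrite mulr0 size_poly0.
    by rewrite mulrC size_mulX.
  rewrite big_ord_recl coefXM mul0r add0r /momL !mulr_sumr -!big_split /=.
  apply: eq_bigr => i _; rewrite coefXM /= ucoefS; ring.
ring.
Qed.

(** In the recurrence, the subtracted multiple of [t] cancels the upper term of [momLx]. *)
Lemma momL_cheb1 m n : momL m (cheb 1 x t%:P n) = (m == n.+1)%:R.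
Proof.
elim/cheb_ind: n m => [m|m|n IH1 IH2 m].
- by rewrite -[cheb _ _ _ _]/(1 : {poly R}) -(expr0 'X) momLXn ucoef_1.
- case: m => [|m]; first by rewrite momL0.
  rewrite -[cheb _ _ _ _]/x -[x]mulr1 momLx -(expr0 'X) !momLXn !ucoef_1.
  by rewrite mulr0 addr0.
case: m => [|m]; first by rewrite momL0.
rewrite chebSS linearB mul_polyC linearZ /= momLx !IH1 !IH2 !eqSS.
by rewrite addrK.
Qed.

(** [S i] stands for u^-i + t^i u^i; the bound keeps the exponent j - i nonnegative. *)
Lemma momL_cheb2 i j f : (i <= j)%N ->
  momL j (S i * f) = momL (j - i) f + t ^+ i * momL (j + i) f.
Proof.
elim/cheb_ind: i j f => [j f _|[|j] f // _|i IH1 IH2 j f ij].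
- by rewrite mul_polyC linearZ /= subn0 addn0; ring.
- by rewrite momLx subSS subn0 addn1 expr1.
rewrite /S chebSS mulrBl linearB /= -mulrA -(mulrCA (S i.+1)) IH2; last by lia.
rewrite mul_polyC -scalerAl linearZ /= IH1; last by lia.
have -> : (j - i.+1 = (j - i.+2).+1)%N by lia.
have -> : (j + i.+1 = (j + i).+1)%N by lia.
rewrite !momLx; have -> : ((j - i.+2).+2 = j - i)%N by lia.
rewrite !addnS !exprS; ring.
Qed.

Variable m : nat.
Hypothesis m_gt0 : (0 < m)%N.
Let D := cheb 1 (S m) (t ^+ m)%:P.

Lemma momL_S k f : momL (k.+1 * m) (S m * f) =
  momL (k * m) f + t ^+ m * momL (k.+2 * m) f.
Proof.
rewrite momL_cheb2; last by rewrite mulSn leq_addr.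
by rewrite {1}mulSn addKn addnC -mulSn.
Qed.

(** The recurrence for [D] subtracts the lower of the two terms of [momL_S], so only the upper one
    survives; the chain starts from [momL0]. *)
Lemma momL_D k f : momL m (D k * f) = t ^+ (m * k) * momL (k.+1 * m) f.
Proof.
elim/cheb_ind: k f => [f|f|k IH1 IH2 f].
- by rewrite !mul1r mul1n muln0 mul1r.
- by rewrite -{1}[m]mul1n momL_S mul0n momL0 add0r muln1.
rewrite /D chebSS mulrBl linearB /= -mulrA -(mulrCA (D k.+1)) IH2.
rewrite mul_polyC -scalerAl linearZ /= IH1 momL_S !mulnS !exprD; ring.
Qed.

Hypothesis mS : monic_deg m (S m).

Lemma size_D_mul k f : (size f < 2 * m)%N -> (size (D k * f)%R < k.+2 * m)%N.
Proof.
have [D1 sD] := monic_cheb1 (t ^+ m) k m_gt0 mS => fm.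
have [->|f0] := eqVneq f 0; first by rewrite mulr0 size_poly0 muln_gt0.
by rewrite size_monicM // sD; lia.
Qed.

(** Here the upper terms of [momL_S] vanish by degree, and the lower ones lead back to index [m]. *)
Lemma momL_D_diag k f : (size f < 2 * m)%N ->
  momL (k.+1 * m) (D k * f) = momL m f.
Proof.
move=> fm; elim/cheb_ind: k => [||k IH1 IH2].
- by rewrite mul1n mul1r.
- by rewrite momL_S [X in _ + _ * X]momL_small ?mulr0 ?addr0 ?mul1n //; lia.
rewrite /D chebSS mulrBl linearB /= -mulrA momL_S IH2.
rewrite [X in _ + _ * X]momL_small; last by apply: (leq_trans (size_D_mul _ fm)); lia.
rewrite mul_polyC -scalerAl linearZ /= [X in _ - _ * X]momL_small ?mulr0 ?addr0 ?subr0 //.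
by apply: (leq_trans (size_D_mul _ fm)); lia.
Qed.

(** For l <= k, [momL_D] trades [D k] for the functional of index (k+1)m, which kills [D l * f] by
    degree unless l = k. *)
Lemma momL_DD k l f : (size f < 2 * m)%N ->
  momL m (D k * D l * f) = (k == l)%:R * t ^+ (m * k) * momL m f.
Proof.
move=> fm; wlog lk : k l / (l <= k)%N => [H|].
  case: (leqP l k) => [|/ltnW] lk; first exact: H.
  rewrite [D k * _]mulrC H // eq_sym.
  by case: eqP => [->|_] //; rewrite !mul0r.
rewrite -mulrA momL_D; case: eqVneq => [->|kl]; first by rewrite momL_D_diag // mul1r.
rewrite momL_small ?mulr0 ?mul0r //.
by rewrite (leq_trans (size_D_mul _ fm)) // leq_mul2r; apply/orP; right; lia.
Qed.
End MomentFunctional.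

(** * Adjugates of sparse matrices as bilinear forms *)

(** The adjugate has the entry det A / w i at (s i, i) and zeros elsewhere; [c i] names this
    quotient without a division. *)
Lemma adj_bilinear_monomial (R : idomainType) n (A : 'M[R]_n) (s : 'I_n -> 'I_n)
    (w c u v : 'I_n -> R) :
  involutive s -> (forall i j, A i j = w i *+ (j == s i)) ->
  (forall i, w i != 0) -> (forall i, w i * c i = \det A) ->
  \sum_i \sum_j u i * (\adj A) i j * v j = \sum_i u (s i) * c i * v i.
Proof.
move=> sK AE w0 cE; rewrite (reindex_inj (inv_inj sK)) /=.
apply: eq_bigr => i _.
have adjE j : (\adj A) (s i) j = c i *+ (i == j).
  apply: (mulfI (w0 i)); rewrite mulrnAr cE.
  have := congr1 (fun M : 'M_n => M i j) (mul_mx_adj A); rewrite !mxE => <-.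
  rewrite (bigD1 (s i)) //= big1 ?addr0 => [|k ks]; first by rewrite AE eqxx mxE.
  by rewrite AE (negbTE ks) mul0r.
rewrite (bigD1 i) //= big1 ?addr0 => [|j ij]; first by rewrite adjE eqxx.
by rewrite adjE eq_sym (negbTE ij) mulr0 mul0r.
Qed.

(** A cofactor that keeps row or column [c] vanishes, so only the one at (c, c) can survive. *)
Lemma adj_bilinear_cross (R : comNzRingType) n (A : 'M[R]_n) c (u v : 'I_n -> R) :
  (forall k, A c k = 0) -> (forall k, A k c = 0) ->
  \sum_i \sum_j u i * (\adj A) i j * v j = u c * \det (A + delta_mx c c) * v c.
Proof.
move=> Ar Ac; rewrite (bigD1 c) //= [X in _ + X]big1 => [|i ic]; last first.
  apply: big1 => j _; rewrite mxE (cofactor_zero_col _ ic Ac).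
  by rewrite mulr0 mul0r.
rewrite addr0 (bigD1 c) //= big1 => [|j jc]; last first.
  by rewrite mxE (cofactor_zero_row _ jc Ar) mulr0 mul0r.
by rewrite addr0 mxE cofactor_zero_cross.
Qed.

Lemma poly_widen (R : nzRingType) n (p : {poly R}) :
  (size p <= n)%N -> p = \sum_(k < n) p`_k *: 'X^k.
Proof.
move=> pn; rewrite -poly_def; apply/polyP=> i; rewrite coef_poly.
by case: ltnP => // ni; rewrite nth_default // (leq_trans pn).
Qed.

(** * A Hankel cofactor in two monic bases *)

Section HankelAdjugate.
Variables (R : idomainType) (t : R) (m N : nat).
Variables (a b : nat -> {poly R}).
Hypotheses (aP : forall i, monic_deg i (a i)) (bP : forall i, monic_deg i (b i)).

Let K := \matrix_(i < N.+1, j < N.+1) ucoef t (i + j).+1 m.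
Let cmx (c : nat -> {poly R}) := \matrix_(i < N.+1, j < N.+1) (c i)`_j.
Let G := \matrix_(i < N.+1, j < N.+1) momL t m (a i * b j).

Lemma det_coef_mx (c : nat -> {poly R}) :
  (forall i, monic_deg i (c i)) -> \det (cmx c) = 1.
Proof.
move=> cP; rewrite det_trig => [|]; last first.
  apply/is_trig_mxP => i j ij; rewrite mxE nth_default //.
  by have [_ ->] := cP i.
apply: big1 => i _; rewrite mxE; have [/monicP + s] := cP i.
by rewrite /lead_coef s.
Qed.

Lemma gram_mxE : G = cmx a *m K *m (cmx b)^T.
Proof.
apply/matrixP=> i j; rewrite !mxE.
have [_ sa] := aP i; have [_ sb] := bP j.
rewrite {1}(@poly_widen _ N.+1 (a i)) ?sa // {1}(@poly_widen _ N.+1 (b j)) ?sb //.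
rewrite mulr_sumr linear_sum /=; apply: eq_bigr => l _.
rewrite mulr_suml linear_sum !mxE mulr_suml; apply: eq_bigr => k _.
rewrite !mxE -scalerAl -scalerAr !linearZ /= -exprD momLXn; ring.
Qed.

(** Both changes of basis are unitriangular, so adj K = B^T (adj G) A. The (0,0) entry sees only the
    first columns of A and B, the constant terms. *)
Lemma cofactor_hankel :
  cofactor K 0 0 =
    \sum_(i < N.+1) \sum_(j < N.+1) (b i)`_0 * (\adj G) i j * (a j)`_0.
Proof.
have -> : cofactor K 0 0 = (\adj K) 0 0 by rewrite mxE.
have -> : \adj K = (cmx b)^T *m \adj G *m cmx a.
  rewrite gram_mxE !adj_mulmx !mulmxA mul_mx_adj det_tr det_coef_mx // mul1mx.
  by rewrite -mulmxA mul_adj_mx det_coef_mx // mulmx1.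
rewrite !mxE exchange_big /=; apply: eq_bigr => j _.
by rewrite !mxE mulr_suml; apply: eq_bigr => i _; rewrite !mxE.
Qed.
End HankelAdjugate.

(** * Palindromic sums, for the polynomial R *)

Section PalindromicSums.
Variables (R : comNzRingType) (y : R).

Definition palsum (c : nat -> R) n :=
  \sum_(i < n.+1) c i * y ^+ i + \sum_(i < n) c i * y ^+ (2 * n - i).

(** Multiplication by [y] moves the centre from n to n+1 and shifts the coefficients by one, which
    leaves the differences [d] of [c]. *)
Lemma palsumS c d n : c 0%N = d 0%N -> (forall i, c i.+1 = c i + d i.+1) ->
  palsum c n.+1 = y * palsum c n + palsum d n.+1.
Proof.
move=> c0 cS; rewrite /palsum mulrDr addrACA; congr (_ + _).
  rewrite big_ord_recl [X in _ = _ + X]big_ord_recl c0 addrCA; congr (_ + _).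
  rewrite mulr_sumr -big_split; apply: eq_bigr => i _ /=.
  rewrite cS /bump /= add1n exprS; ring.
rewrite big_ord_recl [X in _ = _ + X]big_ord_recl c0 addrCA; congr (_ + _).
rewrite mulr_sumr -big_split; apply: eq_bigr => i _ /=.
rewrite cS /bump /= add1n; have in_ := ltn_ord i.
have -> : (2 * n.+1 - i.+1 = (2 * n - i).+1)%N by lia.
rewrite exprS; ring.
Qed.

Lemma sqr_geometric n :
  (\sum_(i < n.+1) y ^+ i) ^+ 2 = palsum (fun i => i.+1%:R) n.
Proof.
elim: n => [|n IH].
  by rewrite /palsum !big_ord_recl !big_ord0 !addr0 mulr1 expr1n.
rewrite (palsumS (d := fun=> 1)) // => [|i]; last by rewrite -natr1.
rewrite -IH /palsum.
have -> : \sum_(i < n.+2) 1 * y ^+ i = \sum_(i < n.+2) y ^+ i.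
  by apply: eq_bigr => i _; rewrite mul1r.
have -> : \sum_(i < n.+1) 1 * y ^+ (2 * n.+1 - i) =
    y * (y ^+ n.+1 * \sum_(i < n.+1) y ^+ i).
  rewrite mulrA -exprS mulr_sumr (reindex_inj rev_ord_inj) /=.
  apply: eq_bigr => i _; rewrite mul1r -exprD; congr (_ ^+ _).
  have := ltn_ord i; lia.
have E1 : \sum_(i < n.+2) y ^+ i = \sum_(i < n.+1) y ^+ i + y ^+ n.+1.
  by rewrite big_ord_recr.
have E2 : \sum_(i < n.+2) y ^+ i = 1 + y * \sum_(i < n.+1) y ^+ i.
  by rewrite big_ord_recl mulr_sumr; congr (_ + _); apply: eq_bigr => i _; rewrite -exprS.
(* One factor is opened at the bottom and the other at the top, so that [y] times the previous
   square appears. *)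
rewrite expr2 {1}E2 E1; ring.
Qed.

(** The differences of C(i+2,2) are i+1, the coefficients found in [sqr_geometric]. *)
Lemma sum_sqr_geometric n :
  \sum_(k < n.+1) y ^+ (n - k) * (\sum_(i < k.+1) y ^+ i) ^+ 2 =
  palsum (fun i => 'C(i + 2, 2)%:R) n.
Proof.
elim: n => [|n IH].
  by rewrite /palsum !big_ord_recl !big_ord0 !addr0 mul1r mulr1 expr1n.
rewrite (palsumS (d := fun i => i.+1%:R)) // => [|i]; last first.
  by rewrite -natrD addSn binS bin1; congr (_%:R); lia.
rewrite -IH -sqr_geometric big_ord_recr /= subnn mul1r; congr (_ + _).
rewrite mulr_sumr; apply: eq_bigr => k _; rewrite mulrA -exprS; congr (_ ^+ _ * _).
have := ltn_ord k; lia.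
Qed.
End PalindromicSums.

(** * The block antidiagonal matrix *)

Section GramMatrix.
Variables (R : comNzRingType) (t : R) (m : nat).
Hypothesis m_gt0 : (0 < m)%N.

Definition gram (i j : nat) : R :=
  ((i %/ m == j %/ m) && (i %% m + j %% m == m.-1))%N%:R * t ^+ (m * (i %/ m)%N).

Lemma gram_shift q i j :
  gram (m * q + i) (m * q + j) = t ^+ (m * q) * gram i j.
Proof.
rewrite /gram ![(m * q)%N]mulnC !divnMDl // !modnMDl eqn_add2l.
by rewrite mulnDr exprD mulrCA [(m * q)%N]mulnC.
Qed.

Lemma gram_lt i j : (i < m)%N -> (j < m)%N -> gram i j = (i + j == m.-1)%N%:R.
Proof.
by move=> im jm; rewrite /gram !divn_small // !modn_small // eqxx muln0 mulr1.
Qed.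

Lemma gram_div_neq i j : (i %/ m != j %/ m)%N -> gram i j = 0.
Proof. by move=> ij; rewrite /gram (negbTE ij) mul0r. Qed.

Lemma gram_upper q i j : (i < m * q)%N -> gram i (m * q + j) = 0.
Proof.
move=> iq; apply: gram_div_neq; rewrite mulnC divnMDl // neq_ltn.
by rewrite (leq_trans (n := q)) ?leq_addr // ltn_divLR // mulnC.
Qed.

(** Without its first block, the matrix is t^m times a smaller copy of itself. *)
Lemma ndet_gram n :
  ndet (m * n) gram = (-1) ^+ ('C(m, 2) * n) * t ^+ (m * (m * 'C(n, 2))).
Proof.
elim: n => [|n IH]; first by rewrite !muln0 ndet0 mulr1.
rewrite mulnS ndet_block => [|i j im jn]; last first.
  by have := @gram_upper 1 i j; rewrite muln1; apply.
rewrite (eq_ndet (g := fun i j => (i + j == m.-1)%N%:R)); last exact: gram_lt.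
rewrite ndet_anti (eq_ndet (g := fun i j => t ^+ m * gram i j)); last first.
  by move=> i j _ _; have := gram_shift 1 i j; rewrite muln1.
rewrite ndetZ IH binS bin1 mulnS !mulnDr !exprD exprM -!exprM; ring.
Qed.

(** The only nonzero entry of this row or column has index [m * q + m.-1], beyond the range of
    [i]. *)
Lemma gram_block_cross q s i : (s < m)%N -> (i < m * q + s)%N ->
  gram (m * q) i = 0 /\ gram i (m * q) = 0.
Proof.
move=> sm iq; suff E : gram i (m * q) = 0 /\ gram (m * q) i = 0 by case: E.
rewrite /gram [(m * q)%N]mulnC mulnK // modnMl addn0 add0n eq_sym.
case: eqP => [iE|_]; last by rewrite !mul0r.
suff -> : (i %% m == m.-1)%N = false by rewrite !mul0r.
move: iq; rewrite {1}(divn_eq i m) -iE [(m * q)%N]mulnC ltn_add2l => iq.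
by apply/negbTE; rewrite neq_ltn; apply/orP; left; lia.
Qed.

(** Here the partner index is m q + (m - 2), again beyond the range. *)
Lemma gram_block_cross1 q s i : (s.+1 < m)%N -> (i < m * q + s)%N ->
  gram (m * q + 1) i = 0 /\ gram i (m * q + 1) = 0.
Proof.
move=> sm iq; suff E : gram i (m * q + 1) = 0 /\ gram (m * q + 1) i = 0 by case: E.
have m1 : (1 < m)%N by lia.
rewrite /gram [(m * q)%N]mulnC divnMDl // modnMDl (divn_small m1) (modn_small m1).
rewrite addn0 [(1 + _)%N]addnC eq_sym.
case: eqP => [iE|_]; last by rewrite !mul0r.
suff -> : (i %% m + 1 == m.-1)%N = false by rewrite !mul0r.
move: iq; rewrite {1}(divn_eq i m) -iE [(m * q)%N]mulnC ltn_add2l => iq.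
by apply/negbTE; rewrite neq_ltn; apply/orP; left; lia.
Qed.

Lemma gram_monomial n i j : (i < m * n)%N -> (j < m * n)%N ->
  gram i j = t ^+ (m * (i %/ m)%N) *+ (j == m * (i %/ m)%N + (m.-1 - i %% m))%N.
Proof.
move=> im jm; rewrite /gram mulr_natl; congr (_ *+ nat_of_bool _).
have := ltn_pmod i m_gt0; have := ltn_pmod j m_gt0.
set r := (i %% m)%N; set s := (j %% m)%N => sm rm.
apply/andP/eqP => [[/eqP -> /eqP rs]|jE].
  by rewrite [in LHS](divn_eq j m) mulnC -rs addKn.
have jd : (j %/ m = i %/ m)%N.
  by rewrite jE mulnC divnMDl // (@divn_small (m.-1 - r)%N) ?addn0 //; lia.
have sE : s = (m.-1 - r)%N.
  by rewrite /s jE mulnC modnMDl (@modn_small (m.-1 - r)%N) //; lia.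
by rewrite jd eqxx sE subnKC //; lia.
Qed.
End GramMatrix.

(** * The two monic bases and their values at z = 0 *)

Section Bases.
Variables (R : comNzRingType) (t : R) (m : nat).
Hypothesis m_gt0 : (0 < m)%N.

Definition chebx : {poly R} := 'X - (1 + t)%:P.
Definition chebS (n : nat) := cheb 2%:P chebx t%:P n.
Definition chebP n := cheb 1 chebx t%:P n.
(* [chebS 0 = 2] is not monic. *)
Definition chebV (n : nat) := if n == 0%N then 1 else chebS n.
Definition chebD k := cheb 1 (chebS m) (t ^+ m)%:P k.
Definition basisL (i : nat) := chebD (i %/ m)%N * chebP (i %% m)%N.
Definition basisR (i : nat) := chebD (i %/ m)%N * chebV (i %% m)%N.

Lemma monic_chebx : monic_deg 1 chebx.
Proof. by split; rewrite ?monicXsubC ?size_XsubC. Qed.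

Lemma monic_chebS n : (0 < n)%N -> monic_deg n (chebS n).
Proof.
by case: n => // n _; have := monic_cheb 2 t n (ltn0Sn 0) monic_chebx; rewrite muln1.
Qed.

Lemma monic_chebP n : monic_deg n (chebP n).
Proof. by have := monic_cheb1 t n (ltn0Sn 0) monic_chebx; rewrite muln1. Qed.

Lemma monic_chebV n : monic_deg n (chebV n).
Proof.
rewrite /chebV; case: eqP => [->|/eqP n0]; last by apply: monic_chebS; lia.
by split; rewrite ?monic1 ?size_poly1.
Qed.

Lemma monic_chebD k : monic_deg (k * m) (chebD k).
Proof. exact: monic_cheb1 (monic_chebS _). Qed.

Lemma monic_basisL i : monic_deg i (basisL i).
Proof.
rewrite {1}(divn_eq i m).
exact: monic_degM (monic_chebD _) (monic_chebP _).
Qed.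

Lemma monic_basisR i : monic_deg i (basisR i).
Proof.
rewrite {1}(divn_eq i m).
exact: monic_degM (monic_chebD _) (monic_chebV _).
Qed.

(** Multiplication by V_s splits the index [m] into m - s and m + s; as r < m, the second
    contributes nothing. *)
Lemma momL_chebPV r s : (r < m)%N -> (s < m)%N ->
  momL t m (chebP r * chebV s) = (r + s == m.-1)%N%:R.
Proof.
move=> rm sm; rewrite /chebV; case: eqP => [->|s0].
  rewrite mulr1 momL_cheb1 addn0; congr (_%:R); lia.
rewrite mulrC momL_cheb2; last by lia.
rewrite !momL_cheb1 [in X in _ + X](_ : (m + s == r.+1)%N = false); last by lia.
by rewrite mulr0 addr0; congr (_%:R); lia.
Qed.

Lemma momL_basis i j : momL t m (basisL i * basisR j) = gram t m i j.
Proof.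
rewrite /basisL /basisR mulrACA.
have rm := ltn_pmod i m_gt0; have sm := ltn_pmod j m_gt0.
rewrite momL_DD //; last 2 first.
- exact: monic_chebS.
- by have [_ ->] := monic_degM (monic_chebP (i %% m)%N) (monic_chebV (j %% m)%N); lia.
by rewrite momL_chebPV // /gram -mulnb natrM -!mulrA [t ^+ _ * _]mulrC.
Qed.

Lemma chebP0 n : (chebP n)`_0 = (-1) ^+ n * \sum_(i < n.+1) t ^+ i.
Proof.
rewrite -horner_coef0 -[_.[0]]/(horner_eval 0 _) /chebP rmorph_cheb /= /horner_eval.
rewrite /chebx !hornerE -cheb1_val ?sqrrN ?expr1n //; congr cheb; ring.
Qed.

Lemma chebS0 n : (chebS n)`_0 = (-1) ^+ n * (1 + t ^+ n).
Proof.
rewrite -horner_coef0 -[_.[0]]/(horner_eval 0 _) /chebS rmorph_cheb /= /horner_eval.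
rewrite /chebx !hornerE -cheb2_val ?sqrrN ?expr1n //; congr cheb; ring.
Qed.

Lemma sqr_chebD0 k : (chebD k)`_0 ^+ 2 = (\sum_(i < k.+1) (t ^+ m) ^+ i) ^+ 2.
Proof.
have e2 : ((-1) ^+ m) ^+ 2 = 1 :> R by rewrite exprAC sqrrN !expr1n.
rewrite -horner_coef0 -[_.[0]]/(horner_eval 0 _) /chebD rmorph_cheb /= /horner_eval.
rewrite !hornerE horner_coef0 chebS0 cheb1_val // exprMn exprAC e2 expr1n mul1r //.
Qed.

Lemma geometricD a b : \sum_(i < a + b) t ^+ i =
  \sum_(i < a) t ^+ i + t ^+ a * \sum_(i < b) t ^+ i.
Proof.
rewrite big_split_ord mulr_sumr; congr (_ + _).
by apply: eq_bigr => i _; rewrite -exprD.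
Qed.

Lemma sum_chebPV0 :
  \sum_(r < m) (chebV (m.-1 - r))`_0 * (chebP r)`_0 =
  (-1) ^+ m.-1 * m%:R * \sum_(i < m) t ^+ i.
Proof.
pose q n := \sum_(i < n) t ^+ i.
(* The last term is split off because [chebV 0] is 1 and not 2. *)
rewrite -(prednK m_gt0) big_ord_recr /= subnn coef1 mul1r chebP0 -/(q _).
set n := m.-1; rewrite mulrSr mulrDr mulrDl mulr1; congr (_ + _).
(* The difference of the last two terms sums to zero under the reversal of [r]. *)
have E (r : 'I_n) : (chebV (n - r))`_0 * (chebP r)`_0 =
    (-1) ^+ n * (q n.+1 + (q r.+1 - q (n - r)%N)).
  have rn := ltn_ord r.
  rewrite /chebV subn_eq0 leqNgt rn chebS0 chebP0 -/(q _).
  have -> : q n.+1 = q (n - r)%N + t ^+ (n - r) * q r.+1.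
    by rewrite -geometricD addnS subnK // ltnW.
  have -> : (-1) ^+ n = (-1) ^+ (n - r) * (-1) ^+ r :> R.
    by rewrite -exprD subnK // ltnW.
  ring.
rewrite (eq_bigr _ (fun r _ => E r)) -mulr_sumr big_split /= sumr_const card_ord.
rewrite sumrB [X in _ - X](reindex_inj rev_ord_inj) /=.
rewrite [X in _ - X](eq_bigr (fun r : 'I_n => q r.+1)) ?subrr ?addr0; last first.
  by move=> r _; rewrite subKn.
by rewrite -[q _ *+ _]mulr_natl mulrA.
Qed.
End Bases.

(** * Values of the Hankel determinants *)

Section HankelValues.
Variables (R : idomainType) (t : R) (m : nat).
Hypotheses (t_neq0 : t != 0) (m_gt1 : (1 < m)%N).
Let m_gt0 : (0 < m)%N := ltnW m_gt1.

Definition hankel_shift2 N := ndet N (fun i j => ucoef t (i + j + 3) m).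
Let geom n y : R := \sum_(i < n) y ^+ i.

(** Deleting row and column 0 of the Hankel matrix of L raises i + j by two. *)
Lemma hankel_shift2_adj N :
  hankel_shift2 N = \sum_(i < N.+1) \sum_(j < N.+1)
    (basisR t m i)`_0 * (\adj (\matrix_(i < N.+1, j < N.+1) gram t m i j)) i j
      * (basisL t m j)`_0.
Proof.
have := @cofactor_hankel _ t m N _ _ (monic_basisL t m_gt0) (monic_basisR t m_gt0).
have -> : \matrix_(i < N.+1, j < N.+1) momL t m (basisL t m i * basisR t m j)
    = \matrix_(i < N.+1, j < N.+1) gram t m i j.
  by apply/matrixP=> i j; rewrite !mxE momL_basis.
move=> <-; rewrite /cofactor mul1r; congr (\det _); apply/matrixP=> i j.
by rewrite !mxE !lift0; congr (ucoef _ _ _); lia.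
Qed.

Lemma basis_mulm k : (basisL t m (m * k))`_0 * (basisR t m (m * k))`_0
  = geom k.+1 (t ^+ m) ^+ 2.
Proof.
rewrite /basisL /basisR mulKn // modnMr /chebP /chebV /= !mulr1.
by rewrite -expr2 sqr_chebD0.
Qed.

(* Row and column [m * q] of the sparse matrix vanish, so only one cofactor
   survives. *)
Lemma hankel_shift2_cross q s : (s.+1 < m)%N ->
  hankel_shift2 (m * q + s) =
  geom q.+1 (t ^+ m) ^+ 2 * (ndet (m * q) (gram t m)
    * (t ^+ (m * q * s) * ndet s (fun i j => (i + j + 2 == m.-1)%N%:R))).
Proof.
move=> sm; rewrite hankel_shift2_adj.
have cN : (m * q < (m * q + s).+1)%N by lia.
pose c := Ordinal cN.
have cross (k : 'I_(m * q + s).+1) := gram_block_cross t m_gt0 sm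
  (eq_ind _ (fun x => k < x)%N (ltn_ord k) _ (esym (addnS _ _))).
rewrite (@adj_bilinear_cross _ _ _ c); first last.
- by move=> k; rewrite mxE; have [] := cross k.
- by move=> k; rewrite mxE; have [] := cross k.
rewrite mulrAC [X in X * _]mulrC basis_mulm; congr (_ * _).
(* With a 1 added at the zero cross, the matrix is block triangular with blocks of sizes m q, 1 and
   s. *)
pose f i j := gram t m i j + ((i == m * q) && (j == m * q))%N%:R.
transitivity (ndet (m * q + (1 + s)) f).
  by rewrite add1n addnS; congr (\det _); apply/matrixP=> i j; rewrite !mxE.
rewrite ndet_block => [|i j iq _]; last first.
  by rewrite /f gram_upper // (ltn_eqF iq) addr0.
congr (_ * _).
  by apply: eq_ndet => i j iq _; rewrite /f (ltn_eqF iq) addr0.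
rewrite ndet_block => [|i j]; last first.
  rewrite /f ltnS leqn0 => /eqP -> js.
  rewrite addn0 (gram_block_cross t m_gt0 sm _).1; last by lia.
  by rewrite add0r eqxx; case: eqP => //; lia.
rewrite [X in X * _]/ndet det_mx11 !mxE /f !addn0 !eqxx.
rewrite (gram_block_cross t m_gt0 sm _).1; last by lia.
rewrite add0r mul1r exprM -ndetZ; apply: eq_ndet => i j si sj.
rewrite gram_shift // gram_lt; [|lia..].
rewrite [X in _ + X](_ : _ = 0) ?addr0; last by case: eqP => //; lia.
by congr (_ * _%:R); lia.
Qed.

Lemma hankel_shift2_mulm n :
  hankel_shift2 (m * n) = (-1) ^+ ('C(m, 2) * n) *
    t ^+ (m * (m * 'C(n, 2))) * geom n.+1 (t ^+ m) ^+ 2.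
Proof.
have := hankel_shift2_cross n m_gt1.
by rewrite addn0 muln0 ndet0 !mulr1 ndet_gram // => ->; rewrite mulrC.
Qed.

(** For s = m - 2 the trailing block of [hankel_shift2_cross] is antidiagonal. *)
Lemma hankel_shift2_mulm_add n : (2 < m)%N ->
  hankel_shift2 (m * n + (m - 2)) = - ((-1) ^+ ('C(m, 2) * n.+1) *
    t ^+ (m * (m * 'C(n, 2)) + m * n * (m - 2)) * geom n.+1 (t ^+ m) ^+ 2).
Proof.
move=> m2; rewrite hankel_shift2_cross; last by lia.
rewrite [ndet (m - 2) _](eq_ndet (g := fun i j => (i + j == (m - 2).-1)%N%:R)); last first.
  by move=> i j _ _; congr (_%:R); lia.
rewrite ndet_gram // ndet_anti exprD mulnSr exprD.
(* The two binomials differ by the odd number 2(m - 2) + 1. *)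
have -> : (-1) ^+ 'C(m, 2) = - (-1) ^+ 'C(m - 2, 2) :> R.
  have -> : ('C(m, 2) = 'C(m - 2, 2) + (m - 2).*2.+1)%N.
    by case: m m2 => [|[|k]] // _; rewrite !subSS subn0 !binS !bin1 bin0; lia.
  by rewrite exprD exprS -muln2 mulnC exprM sqrrN !expr1n; ring.
ring.
Qed.

(** Rows m q and m q + 1 both vanish, so every cofactor keeps a zero row. *)
Lemma hankel_shift2_eq0 q s : (0 < s)%N -> (s + 2 < m)%N ->
  hankel_shift2 (m * q + s) = 0.
Proof.
move=> s0 sm; rewrite hankel_shift2_adj.
have c1 k : (k <= s)%N -> (m * q + k < (m * q + s).+1)%N by lia.
pose c := Ordinal (c1 0%N isT); pose d := Ordinal (c1 1%N s0).
have sm1 : (s.+1 < m)%N by lia.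
have sm2 : (s.+2 < m)%N by lia.
have kE (k : 'I_(m * q + s).+1) : (k < m * q + s.+1)%N by rewrite addnS.
rewrite big1 // => i _; rewrite big1 // => j _; rewrite mxE.
have [jc|jc] := eqVneq j c; last first.
  rewrite (@cofactor_zero_row _ _ _ c) ?mulr0 ?mul0r // => k.
  by rewrite mxE /= addn0 (gram_block_cross t m_gt0 sm1 (kE k)).1.
rewrite (@cofactor_zero_row _ _ _ d) ?mulr0 ?mul0r //.
  by rewrite jc; apply/eqP => /(congr1 val) /=; lia.
by move=> k; rewrite mxE /= (gram_block_cross1 t m_gt0 sm2 (kE k)).1.
Qed.

(** All blocks are complete at size N + 1 = m (n+1), so the matrix is monomial; inside each block
    the sum is [sum_chebPV0]. *)
Lemma hankel_shift2_mulm_pred n :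
  hankel_shift2 (m * n.+1 - 1) = (-1) ^+ m.-1 * (-1) ^+ ('C(m, 2) * n.+1) *
    t ^+ (m * (m * 'C(n.+1, 2)) - m * n) * (m%:R * geom m t *
    \sum_(k < n.+1) (t ^+ m) ^+ (n - k) * geom k.+1 (t ^+ m) ^+ 2).
Proof.
have mn0 : (0 < m * n.+1)%N by rewrite muln_gt0 m_gt0.
rewrite hankel_shift2_adj.
(* Reflection inside each block: the column of the nonzero entry of row [i]. *)
pose sg (i : nat) := (m * (i %/ m) + (m.-1 - i %% m))%N.
have NE : ((m * n.+1 - 1).+1 = m * n.+1)%N by lia.
have sg_div i : (sg i %/ m = i %/ m)%N.
  by rewrite /sg mulnC divnMDl // (@divn_small (m.-1 - i %% m)%N) ?addn0 //; lia.
have sg_mod i : (sg i %% m = m.-1 - i %% m)%N.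
  by rewrite /sg mulnC modnMDl (@modn_small (m.-1 - i %% m)%N) //; lia.
have sgK i : sg (sg i) = i.
  rewrite {1}/sg sg_div sg_mod subKn; last by have := ltn_pmod i m_gt0; lia.
  by rewrite mulnC -divn_eq.
have sgN (i : 'I_(m * n.+1 - 1).+1) : (sg i < (m * n.+1 - 1).+1)%N.
  case: i => i /= iN; rewrite NE mulnC -ltn_divLR // sg_div ltn_divLR //.
  by rewrite mulnC -NE.
pose s i := Ordinal (sgN i).
have dk (i : 'I_(m * n.+1 - 1).+1) : (i %/ m <= n)%N.
  by case: i => i /= iN; rewrite -ltnS ltn_divLR // mulnC -NE.
have ltN (i : 'I_(m * n.+1 - 1).+1) : (i < m * n.+1)%N.
  by case: i => i /=; rewrite NE.
have detE : \det (\matrix_(i < (m * n.+1 - 1).+1, j < (m * n.+1 - 1).+1)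
    gram t m i j) = (-1) ^+ ('C(m, 2) * n.+1) * t ^+ (m * (m * 'C(n.+1, 2))).
  by rewrite -[LHS]/(ndet _ _) NE ndet_gram.
(* The power of [t] in the determinant divided by t^(m k); by [binn] the subtraction is not
   truncated for k <= n. *)
pose e k := (m * (m * 'C(n.+1, 2)) - m * k)%N.
pose cc i : R := (-1) ^+ ('C(m, 2) * n.+1) * t ^+ e (i %/ m)%N.
have binn k : (k <= n)%N -> (k <= m * 'C(n.+1, 2))%N.
  move=> kn; rewrite binS bin1 mulnDr; nia.
rewrite (@adj_bilinear_monomial _ _ _ s
  (fun i => t ^+ (m * (i %/ m))) (fun i => cc i)); first last.
- move=> i; rewrite detE /cc mulrCA -exprD.
  by rewrite subnKC // leq_mul2l binn ?orbT.
- by move=> i; rewrite expf_neq0.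
- by move=> i j; rewrite mxE (@gram_monomial _ _ _ m_gt0 n.+1) ?ltN.
- by move=> i; apply: val_inj; rewrite /= sgK.
pose F (i : nat) := (basisR t m (sg i))`_0 * cc i * (basisL t m i)`_0.
transitivity (\sum_(0 <= i < n.+1 * m) F i).
  have -> : (n.+1 * m = (m * n.+1 - 1).+1)%N by rewrite NE mulnC.
  by rewrite big_mkord.
rewrite big_nat_mul big_mkord mulr_sumr mulr_sumr; apply: eq_bigr => k _.
rewrite -{1}[(k * m)%N]add0n big_addn mulSn addnK big_mkord.
have kn : (k <= n)%N by rewrite -ltnS.
rewrite (eq_bigr (fun r : 'I_m => cc (k * m)%N * (chebD t m k)`_0 ^+ 2 *
   ((chebV t (m.-1 - r))`_0 * (chebP t r)`_0))); last first.
  move=> r _; rewrite /F /basisR /basisL /cc sg_div sg_mod addnC.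
  rewrite divnMDl // modnMDl divn_small // modn_small // addn0 mulnK //.
  by rewrite !coef0M; ring.
rewrite -mulr_sumr sum_chebPV0 // sqr_chebD0 // /cc mulnK // -/(geom _ _) -/(geom _ _).
(* The least exponent, at k = n, is the common factor. *)
have -> : e k = (e n + m * (n - k))%N.
  have : (m * n <= m * (m * 'C(n.+1, 2)))%N by rewrite leq_mul2l binn ?orbT.
  by rewrite /e mulnBr; have := leq_mul (leqnn m) kn; lia.
rewrite exprD [t ^+ (m * (n - k))]exprM /e; ring.
Qed.
End HankelValues.

(** * Translation to the stated formulas *)

Lemma xi1E m n : xi1 m n = (-1) ^+ ('C(m, 2) * n).
Proof. by rewrite /xi1 mulnC bin2 subn1 -divn2. Qed.

Lemma hankelHE m N : (0 < m)%N -> hankelH m N = hankel_shift2 'X m N.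
Proof.
by move=> m0; congr (\det _); apply/matrixP=> i j; rewrite !mxE gamma2mE.
Qed.

Lemma RpolyE m n : Rpoly m n = m%:R * qnum m 'X *
  \sum_(k < n.+1) ('X^m) ^+ (n - k) * (qnum k.+1 ('X ^+ m)) ^+ 2.
Proof.
rewrite /Rpoly /qnum sum_sqr_geometric /palsum big_mkord; congr (_ * (_ + _)).
  by apply: eq_bigr => i _; rewrite exprM.
rewrite -[X in \sum_(X <= _ < _) _]add0n big_addn.
have -> : ((2 * n).+1 - n.+1 = n)%N by lia.
rewrite big_mkord (reindex_inj rev_ord_inj) /=; apply: eq_bigr => i _.
have in_ := ltn_ord i; rewrite -exprM; congr ('C(_, 2)%:R * 'X^(_ * _)); lia.
Qed.

Unset Implicit Arguments.

Theorem theorem1p7 (m : nat) (hm : (3 <= m)%N) :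
  (forall n : nat,
     hankelH m (m * n) =
       xi1 m n * 'X ^+ ((m ^ 2 * n * (n - 1)) %/ 2) * (qnum n.+1 ('X ^+ m)) ^+ 2)
  /\ (forall n : nat, (1 <= n)%N ->
     hankelH m (m * n - 1) =
       (-1) ^+ (m - 1) * xi1 m n * 'X ^+ ((m * (n - 1) * (m * n - 2)) %/ 2)
         * Rpoly m (n - 1))
  /\ (forall n : nat, (1 <= n)%N ->
     hankelH m (m * n - 2) =
       - (xi1 m n * 'X ^+ ((m * (n - 1) * (m * n - 4)) %/ 2)
          * (qnum n ('X ^+ m)) ^+ 2))
  /\ (forall N : nat,
       (forall n : nat, N <> (m * n)%N) ->
       (forall n : nat, (1 <= n)%N -> N <> (m * n - 1)%N) ->
       (forall n : nat, (1 <= n)%N -> N <> (m * n - 2)%N) ->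
       hankelH m N = 0).
Proof.
have m0 : (0 < m)%N by lia.
have m1 : (1 < m)%N by lia.
have X0 : ('X : {poly rat}) != 0 by rewrite polyX_eq0.
have half a b : (b = 2 * a)%N -> (b %/ 2 = a)%N by move=> ->; rewrite mulKn.
have binE n : (2 * 'C(n.+1, 2) = n.+1 * n)%N by rewrite -mul_bin_diag bin1.
split=> [n|]; last split=> [[|n] // _|]; last split=> [[|n] // _|N N0 N1 N2].
- rewrite hankelHE // hankel_shift2_mulm // xi1E; congr (_ * 'X^_ * _).
  apply/esym/half; case: n => [|n]; first by rewrite !muln0.
  by rewrite subn1 -mulnA -binE; lia.
- rewrite hankelHE // hankel_shift2_mulm_pred // xi1E RpolyE !subSS !subn0 subn1.
  congr (_ * 'X^_ * _); apply/esym/half; have := binE n; nia.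
- have -> : (m * n.+1 - 2 = m * n + (m - 2))%N by lia.
  rewrite hankelHE // hankel_shift2_mulm_add // xi1E; congr (- (_ * 'X^_ * _)).
  rewrite subSS subn0; apply/esym/half.
  (* At n = 0 the difference [m * n.+1 - 4] is truncated when m = 3, but the factor [n] makes the
     exponent zero. *)
  have [->|n0] := posnP n; first by rewrite !muln0.
  have := binE n.-1; rewrite prednK // => E.
  have -> : (m * n.+1 - 4 = m * n.-1 + 2 * (m - 2))%N.
    by rewrite -[in LHS](prednK n0) !mulnS; lia.
  transitivity (m * (m * (n * n.-1)) + 2 * (m * n * (m - 2)))%N; last by rewrite -E; lia.
  by rewrite mulnDr; lia.
(* The exclusions leave residues from 1 to m - 3: m - 1 and m - 2 are ruled out by the multiple of
   [m] just above [N]. *)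
rewrite hankelHE // (divn_eq N m) mulnC hankel_shift2_eq0 //.
  case: (posnP (N %% m)%N) => // E; case: (N0 (N %/ m)%N).
  by rewrite {1}(divn_eq N m) E addn0 mulnC.
have := N1 (N %/ m).+1 isT; have := N2 (N %/ m).+1 isT.
have := ltn_pmod N m0; have := divn_eq N m; rewrite mulnS [(m * _)%N]mulnC.
lia.
Qed.
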